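(* For every integer $d \geq 4$ there exists an integral convex polytope $\mathcal{P}$ of dimension $d$ such that each of the coefficients of $n, n^2, \ldots, n^{d-2}$ in its Ehrhart polynomial $i(\mathcal{P},n)$ is negative.
   Context: A convex polytope $\mathcal{P} \subset \mathbb{R}^N$ is integral if all its vertices have integer coordinates. For an integral convex polytope $\mathcal{P}$ of dimension $d$, the Ehrhart polynomial $i(\mathcal{P},n)$ is the polynomial in $n$ (of degree $d$ with constant term $1$) satisfying $i(\mathcal{P},n) = \#(n\mathcal{P} \cap \mathbb{Z}^N)$ for all positive integers $n$, where $n\mathcal{P} = \{n\alpha : \alpha \in \mathcal{P}\}$. *)

(* Defs.v *)
From mathcomp Require Import all_boot all_order all_algebra finmap.
From mathcomp Require Import mathcomp_extra boolp classical_sets functions.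
From mathcomp Require Import cardinality reals.

Set Implicit Arguments.
Unset Strict Implicit.
Unset Printing Implicit Defensive.

Import Order.TTheory GRing.Theory Num.Theory.
Local Open Scope classical_set_scope.
Local Open Scope ring_scope.

Definition affine_hull (R : realType) (N : nat) (S : set 'rV[R]_N) :
    set 'rV[R]_N :=
  [set x | exists (k : nat) (a : 'I_k -> R) (v : 'I_k -> 'rV[R]_N),
    [/\ forall i, S (v i),
        \sum_(i < k) a i = 1
      & x = \sum_(i < k) a i *: v i]].

Definition convex_hull (R : realType) (N : nat) (S : set 'rV[R]_N) :
    set 'rV[R]_N :=
  [set x | exists (k : nat) (a : 'I_k -> R) (v : 'I_k -> 'rV[R]_N),
    [/\ forall i, S (v i),
        forall i, 0 <= a i,
        \sum_(i < k) a i = 1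
      & x = \sum_(i < k) a i *: v i]].

Definition convex_polytope (R : realType) (N : nat) (P : set 'rV[R]_N) : Prop :=
  exists2 S : set 'rV[R]_N, finite_set S & P = convex_hull S.

(* The vertices of a convex polytope, described as its extreme points. *)
Definition vertex (R : realType) (N : nat) (P : set 'rV[R]_N) (v : 'rV[R]_N) :
    Prop :=
  P v /\
  forall (x y : 'rV[R]_N) (t : R), P x -> P y -> 0 < t < 1 ->
    v = t *: x + (1 - t) *: y -> x = v /\ y = v.

Definition lattice_points (R : realType) (N : nat) : set 'rV[R]_N :=
  [set x | forall j, x ord0 j \is a Num.int].

Definition integral_polytope (R : realType) (N : nat) (P : set 'rV[R]_N) :
    Prop :=
  convex_polytope P /\ vertex P `<=` @lattice_points R N.

Definition has_dim (R : realType) (N : nat) (P : set 'rV[R]_N) (d : nat) :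
    Prop :=
  exists (x0 : 'rV[R]_N) (U : {vspace 'rV[R]_N}),
    \dim U = d /\ affine_hull P = [set x | x - x0 \in U].

Definition dilate (R : realType) (N : nat) (n : nat) (P : set 'rV[R]_N) :
    set 'rV[R]_N :=
  [set n%:R *: x | x in P].

(* p is the Ehrhart polynomial of the d-dimensional integral polytope P.  It is
   unique, since its values at all positive integers are prescribed.  The
   finiteness clause is there because fset_set is empty on infinite sets. *)
Definition ehrhart_polynomial (R : realType) (N : nat) (P : set 'rV[R]_N)
    (d : nat) (p : {poly R}) : Prop :=
  [/\ size p = d.+1,
      p`_0 = 1
    & forall n : nat, (0 < n)%N ->
        let L := dilate n P `&` @lattice_points R N in
        finite_set L /\ p.[n%:R] = #|` fset_set L|%:R].

(* Main.v *)
Require Import Defs.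
From mathcomp Require Import all_boot all_order all_algebra finmap.
From mathcomp Require Import boolp classical_sets cardinality reals.
From mathcomp Require Import ring lra zify.

(* The polytope is T x [0, a]^(d - 3), where T is the Reeve tetrahedron with
   vertices (b, c, m b c) for b, c in {0, 1}.  Above a lattice point (x, y) of
   [0, n]^2 the tetrahedron n T has m (min x y - max 0 (x + y - n)) + 1 lattice
   points, so with m = 6 M the Ehrhart polynomial is
   (M n^3 + n^2 + (2 - M) n + 1) (a n + 1)^(d - 3).  If q_j denotes the
   coefficient of n^j in (a n + 1)^(d - 3), the coefficient of n^k in the product
   is M (q_{k-3} - q_{k-1}) + q_{k-2} + 2 q_{k-1} + q_k.  For a = d - 2 the q_j
   are strictly increasing integers, so this is negative for 1 <= k <= d - 2 as
   soon as M is large. *)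

Set Implicit Arguments.
Unset Strict Implicit.
Unset Printing Implicit Defensive.

Import Order.TTheory GRing.Theory Num.Theory.
Local Open Scope classical_set_scope.
Local Open Scope ring_scope.

(** * Convex and affine hulls *)

(** Reindexing along [enum_val] frees the combination from ordinals, so that tuples of booleans can
    index the points. *)
Lemma convex_hull_fin (R : realType) (N : nat) (S : set 'rV[R]_N) (I : finType)
    (a : I -> R) (v : I -> 'rV[R]_N) :
  (forall i, S (v i)) -> (forall i, 0 <= a i) -> \sum_i a i = 1 ->
  convex_hull S (\sum_i a i *: v i).
Proof.
move=> Sv a_ge0 sum_a.
exists #|I|, (a \o enum_val), (v \o enum_val); split=> /= [i|i||] //.
  by rewrite -sum_a [RHS]big_enum_val.
by rewrite big_enum_val.
Qed.

Lemma affine_hull_fin (R : realType) (N : nat) (S : set 'rV[R]_N) (I : finType)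
    (a : I -> R) (v : I -> 'rV[R]_N) :
  (forall i, S (v i)) -> \sum_i a i = 1 -> affine_hull S (\sum_i a i *: v i).
Proof.
move=> Sv sum_a.
exists #|I|, (a \o enum_val), (v \o enum_val); split=> /= [i||] //.
  by rewrite -sum_a [RHS]big_enum_val.
by rewrite big_enum_val.
Qed.

Lemma sub_convex_hull (R : realType) (N : nat) (S : set 'rV[R]_N) :
  S `<=` convex_hull S.
Proof.
move=> v Sv; exists 1%N, (fun=> 1), (fun=> v).
by split=> //; rewrite big_ord1 ?scale1r.
Qed.

(** Some point of the combination has positive weight. If that weight is 1, the vertex is this
    point; otherwise the vertex lies strictly between it and the renormalised combination of the
    others, and extremality identifies the two. *)
Lemma vertex_convex_hull (R : realType) (N : nat) (S : set 'rV[R]_N) :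
  vertex (convex_hull S) `<=` S.
Proof.
move=> v [[k [a [w [Sw a_ge0 sum_a def_v]]]] extr].
have [i a_gt0] : exists i, 0 < a i.
  apply/not_existsP => a_le0; have := oner_neq0 R; rewrite -sum_a big1 ?eqxx//.
  move=> i _; apply/eqP; rewrite eq_le a_ge0 andbT leNgt.
  exact/negP/a_le0.
have rest : \sum_(j | j != i) a j = 1 - a i.
  by rewrite -[X in X - _]sum_a [in RHS](bigD1 i) //= addrAC subrr add0r.
have a_le1 : a i <= 1 by rewrite -subr_ge0 -rest sumr_ge0.
have [a1|a_neq1] := eqVneq (a i) 1.
  have a0 j : j != i -> a j = 0.
    have : \sum_(j | j != i) a j = 0 by rewrite rest a1 subrr.
    by move/eqP; rewrite psumr_eq0 // => /allP /(_ j (mem_index_enum j)) /implyP H /H /eqP.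
  rewrite def_v (bigD1 i) //= a1 scale1r big1 ?addr0 // => j /a0 ->.
  by rewrite scale0r.
have lt_a1 : 0 < 1 - a i by rewrite subr_gt0 lt_neqAle a_neq1.
(* The remaining weights, rescaled to have sum 1. *)
pose b j := if j == i then 0 else a j / (1 - a i).
have hull_y : convex_hull S (\sum_j b j *: w j).
  apply: convex_hull_fin => // [j|].
    by rewrite /b; case: eqP => // _; rewrite divr_ge0 // ltW.
  rewrite (bigD1 i) //= /b eqxx add0r.
  rewrite (eq_bigr (fun j => a j / (1 - a i))) => [|j /negbTE -> //].
  by rewrite -mulr_suml rest divff // gt_eqF.
have [||<- //] := extr (w i) _ (a i) (sub_convex_hull (Sw i)) hull_y.
  by rewrite a_gt0 /= -subr_gt0.
rewrite def_v (bigD1 i) //=; congr (_ + _).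
rewrite [in RHS](bigD1 i) //= {1}/b eqxx scale0r add0r scaler_sumr.
apply: eq_bigr => j /negbTE ji; rewrite /b ji scalerA mulrC divfK //.
by rewrite gt_eqF.
Qed.

(** * Lattice points of the dilated tetrahedron *)

Section Counting.
Local Open Scope nat_scope.

(** Truncated subtraction kills the terms with [y < n - x]; the others run through 0, ..., x. *)
Lemma sum_subn_ord (n x : nat) : x <= n ->
  \sum_(y < n.+1) (x + y - n) = 'C(x.+1, 2).
Proof.
move=> le_xn; rewrite -triangular_sum -(big_mkord predT (fun y => x + y - n)).
rewrite (big_cat_nat (n := n - x)) //=; last by lia.
rewrite big_nat big1 ?add0n => [|i /andP[_ lt_i]]; last by lia.
rewrite -{1}[n - x]add0n big_addn subSn ?subKn //; last by lia.
by rewrite !big_mkord; apply: eq_bigr => i _; have := ltn_ord i; lia.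
Qed.

(** The deficits [x - y] for [y <= x] sum to the binomial coefficient, which stands on the left to
    avoid subtraction in [nat]. *)
Lemma sum_minn_ord (n x : nat) : x <= n ->
  \sum_(y < n.+1) minn x y + 'C(x.+1, 2) = x * n.+1.
Proof.
elim: n => [|n IHn] in x *.
  by rewrite leqn0 => /eqP ->; rewrite big_ord1.
rewrite leq_eqVlt ltnS => /predU1P[-> {x}|le_xn].
  have -> : \sum_(y < n.+2) minn n.+1 y = 'C(n.+2, 2).
    rewrite -triangular_sum big_mkord; apply: eq_bigr => i _.
    by apply/minn_idPr; rewrite -ltnS.
  by rewrite addnn bin2 /= -[RHS]mulnC; have := odd_double_half (n.+2 * n.+1); rewrite oddM /= ; lia.
rewrite big_ord_recr /= (minn_idPl _) ?(leq_trans le_xn) //.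
by rewrite addnAC IHn //; lia.
Qed.

(** The double sum is (n + 1) C(n + 1, 2) - 2 C(n + 2, 3) = (n^3 - n) / 6; denominator and
    subtraction are cleared. *)
Lemma sum_reeve_height (n : nat) :
  6 * (\sum_(x < n.+1) \sum_(y < n.+1) (minn x y - (x + y - n))) + n = n ^ 3.
Proof.
have E (x : 'I_n.+1) :
   \sum_(y < n.+1) (minn x y - (x + y - n)) + 2 * 'C(x.+1, 2) = x * n.+1.
  have le_xn : x <= n by rewrite -ltnS.
  rewrite -(sum_minn_ord le_xn) mul2n -addnn addnA; congr (_ + _).
  rewrite -(sum_subn_ord le_xn) -big_split; apply: eq_bigr => y _ /=.
  by rewrite subnK //; have := ltn_ord y; lia.
have S : \sum_(x < n.+1) \sum_(y < n.+1) (minn x y - (x + y - n))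
   + \sum_(x < n.+1) 2 * 'C(x.+1, 2) = 'C(n.+1, 2) * n.+1.
  rewrite -big_split (eq_bigr _ (fun x _ => E x)) -big_distrl /=.
  by rewrite -triangular_sum big_mkord.
move: S; rewrite -big_distrr /=.
(* The hockey-stick identity. *)
have -> : \sum_(x < n.+1) 'C(x.+1, 2) = 'C(n.+2, 3).
  elim: (n) => [|k IHk]; first by rewrite big_ord1.
  by rewrite big_ord_recr IHk /= [RHS]binS addnC.
(* Falling factorials turn the binomials into products, which leaves polynomial arithmetic. *)
have := bin_ffact n.+2 3; have := bin_ffact n.+1 2.
rewrite !ffactnS !ffactn0 /= !factS fact0; nia.
Qed.

Lemma card_ord_itv (k lo hi : nat) : lo <= hi -> hi <= k ->
  \sum_(z < k.+1) (lo <= z <= hi) = (hi - lo).+1.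
Proof.
move=> le_lohi le_hik; rewrite -(big_mkord predT (fun z => (lo <= z <= hi) : nat)).
rewrite (big_cat_nat (n := lo)) //=; last by lia.
rewrite (big_cat_nat (m := lo) (n := hi.+1)) //=; try lia.
rewrite big_nat big1 => [|i /andP[_ lt_i]]; last by lia.
rewrite (@big_nat _ _ _ hi.+1) (@big1 _ _ _ _ (index_iota hi.+1 _)) => [|i /andP[lt_i _]]; last by lia.
rewrite add0n addn0 (eq_big_nat _ _ (F2 := fun=> 1)) => [|i /andP[? ?]]; last by lia.
by rewrite sum_nat_const_nat muln1 subSn.
Qed.

(** For fixed [x] and [y] the admissible [z] form an interval with one more point than its length;
    these extra points make up [n.+1 ^ 2]. *)
Lemma sum_reeve_points (n m : nat) :
  \sum_(x < n.+1) \sum_(y < n.+1) \sum_(z < (m * n).+1)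
     (m * (x + y) - m * n <= z <= m * minn x y)
  = n.+1 ^ 2 + m * \sum_(x < n.+1) \sum_(y < n.+1) (minn x y - (x + y - n)).
Proof.
have -> : n.+1 ^ 2 = \sum_(x < n.+1) \sum_(y < n.+1) 1.
  by rewrite !sum_nat_const !card_ord muln1 mulnn.
rewrite big_distrr -big_split; apply: eq_bigr => x _.
rewrite big_distrr -big_split; apply: eq_bigr => y _ /=.
have := ltn_ord x; have := ltn_ord y => lt_y lt_x.
rewrite -mulnBr card_ord_itv ?leq_mul2l ?mulnBr; lia.
Qed.

End Counting.

(** * The prism over the Reeve tetrahedron *)

Section Point.
Variables (R : realType) (e : nat).

Definition prism_point (x y z : R) (w : 'I_e -> R) : 'rV[R]_(3 + e) :=
  row_mx (\row_(i < 3) [:: x; y; z]`_i) (\row_j w j).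


Lemma prism_pointP (v : 'rV[R]_(3 + e)) : exists x y z w, v = prism_point x y z w.
Proof.
pose c k := v ord0 (lshift e k).
exists (c 0), (c 1), (c 2), (fun j => v ord0 (rshift 3 j)).
apply/rowP => i; rewrite /prism_point mxE; case: splitP => j def_i; rewrite mxE.
  case: j def_i => -[|[|[|//]]] lt_j /= def_i; congr (v _ _); exact/val_inj.
by congr (v _ _); apply/val_inj.
Qed.

Lemma prism_point_inj x y z w x' y' z' w' : prism_point x y z w = prism_point x' y' z' w' ->
  [/\ x = x', y = y', z = z' & w =1 w'].
Proof.
move=> /eq_row_mx[/rowP h /rowP hw].
have := (h 0, h 1, h 2); rewrite !mxE /= => -[[-> ->] ->]; split=> // j.
by have := hw j; rewrite !mxE.
Qed.

Lemma sum_prism_point (I : finType) (a x y z : I -> R) (w : I -> 'I_e -> R) :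
  \sum_i a i *: prism_point (x i) (y i) (z i) (w i) =
  prism_point (\sum_i a i * x i) (\sum_i a i * y i) (\sum_i a i * z i)
    (fun j => \sum_i a i * w i j).
Proof.
apply/rowP => i; rewrite summxE /prism_point mxE.
case: splitP => j def_i; rewrite mxE.
  transitivity (\sum_k a k * [:: x k; y k; z k]`_j).
    apply: eq_bigr => k _; rewrite mxE; congr (_ * _).
    by rewrite (_ : i = lshift e j) ?row_mxEl ?mxE //; apply/val_inj.
  by case: j def_i => -[|[|[|//]]].
apply: eq_bigr => k _; rewrite mxE; congr (_ * _).
by rewrite (_ : i = rshift 3 j) ?row_mxEr ?mxE //; apply/val_inj.
Qed.

Lemma lattice_prism_point x y z w : lattice_points (prism_point x y z w) <->
  [/\ x \is a Num.int, y \is a Num.int, z \is a Num.int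
    & forall j, w j \is a Num.int].
Proof.
split=> [h|[hx hy hz hw] i].
  split=> [|||j].
  - by have := h (lshift e 0); rewrite row_mxEl mxE.
  - by have := h (lshift e 1); rewrite row_mxEl mxE.
  - by have := h (lshift e 2); rewrite row_mxEl mxE.
  - by have := h (rshift 3 j); rewrite row_mxEr mxE.
rewrite mxE; case: splitP => j _; rewrite mxE //.
by case: j => -[|[|[|//]]].
Qed.

End Point.

(** * Barycentric weights and facet inequalities of the prism *)

Section Prism.
Variables (R : realType) (e m a : nat).
Hypotheses (m_gt0 : (0 < m)%N) (a_gt0 : (0 < a)%N).

Local Notation index := (bool * bool * {ffun 'I_e -> bool})%type.

Definition prism_vertex (i : index) : 'rV[R]_(3 + e) :=
  prism_point i.1.1%:R i.1.2%:R (m * (i.1.1 && i.1.2))%:R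
    (fun j => (a * i.2 j)%:R).

Definition prism : set 'rV[R]_(3 + e) := convex_hull (range prism_vertex).

(** Barycentric coordinates of (x, y, z) with respect to the four vertices (b, c, m b c). *)
Definition tetra_weight (x y z : R) (b c : bool) : R :=
  let s := z / m%:R in
  match b, c with
  | true, true => s
  | true, false => x - s
  | false, true => y - s
  | false, false => 1 - x - y + s
  end.

(** Product weights: independently for each [j], the corner coordinate [a] has weight [w j / a] and
    0 has the complementary weight. *)
Definition cube_weight (w : 'I_e -> R) (f : {ffun 'I_e -> bool}) : R :=
  \prod_j (if f j then w j / a%:R else 1 - w j / a%:R).

Definition prism_weight x y z w (i : index) : R :=
  tetra_weight x y z i.1.1 i.1.2 * cube_weight w i.2.

Lemma sum_cube_weight w : \sum_f cube_weight w f = 1.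
Proof.
rewrite -(bigA_distr_bigA (fun j (b : bool) => if b then _ else _)) /=.
by rewrite big1 // => j _; rewrite big_bool /= addrC subrK.
Qed.

(** The value [a * f k] is absorbed into the factor of index [k]. After distributing, that factor
    sums to [w k] and every other one to 1. *)
Lemma sum_cube_weight_coord w k :
  \sum_f cube_weight w f * (a * f k)%:R = w k.
Proof.
pose g j (b : bool) : R :=
  (if b then w j / a%:R else 1 - w j / a%:R) * (if j == k then (a * b)%:R else 1).
transitivity (\sum_(f : {ffun 'I_e -> bool}) \prod_j g j (f j)).
  apply: eq_bigr => f _; rewrite big_split /=; congr (_ * _).
  by rewrite -big_mkcond big_pred1_eq.
rewrite -bigA_distr_bigA (bigD1 k) //= [X in _ * X]big1 => [|j /negbTE jk].
  rewrite big_bool /g /= eqxx muln1 muln0 mulr0 addr0 mulr1 divfK //.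
  by rewrite pnatr_eq0 -lt0n.
by rewrite big_bool /g jk /= !mulr1 addrC subrK.
Qed.

Lemma sum_index (F : bool -> bool -> R) (G : {ffun 'I_e -> bool} -> R) :
  \sum_(i : index) F i.1.1 i.1.2 * G i.2 =
  (F true true + F true false + F false true + F false false) * \sum_f G f.
Proof.
rewrite -(pair_bigA _ (fun (i : bool * bool) f => F i.1 i.2 * G f)) /=.
rewrite -(pair_bigA _ (fun b c => \sum_f F b c * G f)) /=.
by rewrite !big_bool /= -!mulr_sumr !mulrDl !addrA.
Qed.

Lemma sum_prism_weight x y z w : \sum_i prism_weight x y z w i = 1.
Proof. rewrite sum_index sum_cube_weight /tetra_weight; ring. Qed.

(** Every point of the space is thus an affine combination of the vertices, which yields the
    dimension; the prism is the region where these weights are nonnegative. *)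
Lemma sum_prism_vertex x y z w :
  \sum_i prism_weight x y z w i *: prism_vertex i = prism_point x y z w.
Proof.
have m0 : m%:R != 0 :> R by rewrite pnatr_eq0 -lt0n.
have E (h : bool -> bool -> nat) :
  \sum_i prism_weight x y z w i * (h i.1.1 i.1.2)%:R =
  \sum_b \sum_c tetra_weight x y z b c * (h b c)%:R.
  under eq_bigr do rewrite mulrAC.
  rewrite (sum_index (fun b c => tetra_weight x y z b c * (h b c)%:R)).
  by rewrite sum_cube_weight mulr1 !big_bool /= !addrA.
rewrite sum_prism_point (E (fun b _ => b)) (E (fun _ c => c)).
rewrite (E (fun b c => (m * (b && c))%N)) !big_bool /=.
congr prism_point; rewrite /tetra_weight ?muln1 ?muln0; [ring|ring|by field|].
apply/funext => j; under eq_bigr do rewrite -mulrA.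
rewrite (sum_index (tetra_weight x y z) (fun f => cube_weight w f * (a * f j)%:R)).
by rewrite sum_cube_weight_coord /tetra_weight; ring.
Qed.

(** From left to right, each inequality holds at every vertex and survives averaging. From right to
    left, the inequalities make all weights nonnegative. *)
Lemma mem_prism x y z w : prism (prism_point x y z w) <->
  [/\ 0 <= z, z <= m%:R * x, z <= m%:R * y, m%:R * (x + y) <= z + m%:R
    & forall j, 0 <= w j <= a%:R].
Proof.
split=> [[k [c [v [Sv c_ge0 sum_c]]]]|[z_ge0 le_zx le_zy le_xyz w_itv]].
  have /choice[t def_v] i : exists t, v i = prism_vertex t.
    by have [t _ <-] := Sv i; exists t.
  under eq_bigr do rewrite def_v; rewrite sum_prism_point => /prism_point_inj[-> -> -> def_w].
  (* A constant is its own average, so the bounds can be compared vertex by vertex. *)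
  have sum_cst u : u = \sum_i c i * u by rewrite -mulr_suml sum_c mul1r.
  split=> [||||j].
  - by apply: sumr_ge0 => i _; rewrite mulr_ge0 // ler0n.
  - rewrite mulr_sumr; apply: ler_sum => i _; rewrite mulrCA ler_wpM2l // -natrM.
    by rewrite ler_nat leq_mul2l; case: (t i).1 => -[] [] /=; rewrite orbT.
  - rewrite mulr_sumr; apply: ler_sum => i _; rewrite mulrCA ler_wpM2l // -natrM.
    by rewrite ler_nat leq_mul2l; case: (t i).1 => -[] [] /=; rewrite orbT.
  - rewrite [X in _ <= _ + X]sum_cst -!big_split mulr_sumr.
    apply: ler_sum => i _ /=; rewrite -!mulrDr mulrCA ler_wpM2l //.
    rewrite -natrD -natrM -natrD ler_nat.
    by case: (t i).1 => -[] [] /=; lia.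
  - rewrite def_w sumr_ge0 => [|i _]; last by rewrite mulr_ge0 ?ler0n.
    rewrite [leRHS]sum_cst; apply: ler_sum => i _.
    by rewrite ler_wpM2l // ler_nat; case: ((t i).2 j); rewrite ?muln1 ?muln0.
rewrite -sum_prism_vertex; apply: convex_hull_fin => [i|[[b c] f]|].
- by exists i.
- have m0 : 0 < m%:R :> R by rewrite ltr0n.
  have a0 : 0 < a%:R :> R by rewrite ltr0n.
  apply: mulr_ge0.
    rewrite /tetra_weight; case: b c => -[] /=.
    + by rewrite divr_ge0 // ltW.
    + by rewrite subr_ge0 ler_pdivrMr // mulrC.
    + by rewrite subr_ge0 ler_pdivrMr // mulrC.
    + rewrite -(pmulr_rge0 _ m0) !mulrDr !mulrN mulr1 [m%:R * (z / _)]mulrC.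
      by rewrite divfK ?gt_eqF //; lra.
  apply: prodr_ge0 => j _; have /andP[w_ge0 w_le] := w_itv j.
  by case: (f j); rewrite ?subr_ge0 ?ler_pdivrMr ?mul1r // divr_ge0 // ltW.
- exact: sum_prism_weight.
Qed.

Lemma integral_prism : integral_polytope prism.
Proof.
split.
  by exists (range prism_vertex) => //; apply: finite_image; apply: finite_finset.
move=> v /vertex_convex_hull [i _ <-]; apply/lattice_prism_point.
by split=> *; apply: natr_int.
Qed.

Lemma has_dim_prism : has_dim prism (3 + e).
Proof.
exists 0, fullv; split; first by rewrite dimvf /dim /= mul1n.
apply/seteqP; split=> v _ /=; first exact: memvf.
have [x [y [z [w ->]]]] := prism_pointP v; rewrite -sum_prism_vertex.
apply: affine_hull_fin => [i|]; last exact: sum_prism_weight.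
by apply: sub_convex_hull; exists i.
Qed.

(** * Lattice points of the dilated prism *)

Section Dilate.
Variable n : nat.
Hypothesis n_gt0 : (0 < n)%N.

Lemma mem_dilate_prism x y z w : dilate n prism (prism_point x y z w) <->
  [/\ 0 <= z, z <= m%:R * x, z <= m%:R * y, m%:R * (x + y) <= z + (m * n)%:R
    & forall j, 0 <= w j <= (a * n)%:R].
Proof.
have n0 : 0 < n%:R :> R by rewrite ltr0n.
have scale_prism_point c x' y' z' w' : c *: prism_point x' y' z' w' =
    prism_point (c * x') (c * y') (c * z') (fun j => c * w' j) :> 'rV[R]_(3 + e).
  have := @sum_prism_point R e 'I_1 (fun=> c) (fun=> x') (fun=> y') (fun=> z') (fun=> w').
  rewrite !big_ord1 => ->; congr prism_point.
  by apply/funext => j; rewrite big_ord1.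
split=> [[v Pv]|[z_ge0 le_zx le_zy le_xyz w_itv]].
  have [x' [y' [z' [w' def_v]]]] := prism_pointP v; move: Pv; rewrite {}def_v.
  move=> /mem_prism[? ? ? ? w_itv]; rewrite scale_prism_point => /prism_point_inj[<- <- <- def_w].
  split=> [||||j].
  - by rewrite mulr_ge0 // ltW.
  - by rewrite mulrCA ler_pM2l.
  - by rewrite mulrCA ler_pM2l.
  - by rewrite -mulrDr natrM [m%:R * n%:R]mulrC mulrCA -mulrDr ler_pM2l.
  - rewrite -def_w natrM [a%:R * _]mulrC ler_pM2l // pmulr_rge0 //.
exists (prism_point (x / n%:R) (y / n%:R) (z / n%:R) (fun j => w j / n%:R)); last first.
  have K (u : R) : n%:R * (u / n%:R) = u by rewrite mulrC divfK // gt_eqF.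
  by rewrite scale_prism_point; congr prism_point => //; apply/funext => j; rewrite K.
apply/mem_prism; split=> [||||j].
- by rewrite divr_ge0 // ltW.
- by rewrite mulrA ler_pM2r ?invr_gt0.
- by rewrite mulrA ler_pM2r ?invr_gt0.
- by rewrite -mulrDl mulrA ler_pdivrMr // mulrDl -natrM divfK // gt_eqF.
- have /andP[w_ge0 w_le] := w_itv j.
  by rewrite ler_pdivrMr // -natrM w_le divr_ge0 // ltW.
Qed.

Local Notation box :=
  ('I_n.+1 * 'I_n.+1 * 'I_(m * n).+1 * {ffun 'I_e -> 'I_(a * n).+1})%type.

Definition box_point (t : box) : 'rV[R]_(3 + e) :=
  prism_point t.1.1.1%:R t.1.1.2%:R t.1.2%:R (fun j => (t.2 j)%:R).

(** Truncated subtraction merges [0 <= z] with the lower slanted facet; the cube coordinates are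
    bounded by the type [box] alone. *)
Definition dilated_prism_points : {set box} :=
  [set t : box | (m * (t.1.1.1 + t.1.1.2) - m * n <= t.1.2
                   <= m * minn t.1.1.1 t.1.1.2)%N].

Lemma box_point_inj : injective box_point.
Proof.
move=> [[[x y] z] w] [[[x' y'] z'] w'] /prism_point_inj[/= hx hy hz hw].
have natI := mulrIn (oner_neq0 R).
have -> : x = x' by apply/val_inj/natI.
have -> : y = y' by apply/val_inj/natI.
have -> : z = z' by apply/val_inj/natI.
by congr (_, _); apply/ffunP => j; apply/val_inj/natI/hw.
Qed.

Lemma dilate_prism_lattice :
  dilate n prism `&` @lattice_points R (3 + e) =
  [set box_point t | t in [set` dilated_prism_points]].
Proof.
apply/seteqP; split=> [v [Pv Lv]|v [[[[x y] z] w] /=]]; last first.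
  rewrite inE /= => /andP[le_lo le_hi] <-; split; last first.
    by apply/lattice_prism_point; split=> *; apply: natr_int.
  apply/mem_dilate_prism; rewrite -natrD -!natrM -natrD !ler_nat ler0n; split=> //.
  - by apply: leq_trans le_hi _; rewrite leq_mul2l geq_minl orbT.
  - by apply: leq_trans le_hi _; rewrite leq_mul2l geq_minr orbT.
  - by rewrite [leqRHS]addnC -leq_subLR.
  - by move=> j; rewrite ler0n ler_nat -ltnS /=.
have [x [y [z [w def_v]]]] := prism_pointP v; move: Pv Lv; rewrite {v}def_v.
move=> /mem_dilate_prism[z_ge0 le_zx le_zy le_xyz w_itv] /lattice_prism_point[xZ yZ zZ wZ].
have m0 : 0 < m%:R :> R by rewrite ltr0n.
(* Nonnegativity of [x] and [y] is implicit in 0 <= z <= m x and 0 <= z <= m y. *)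
have x_ge0 : 0 <= x by rewrite -(pmulr_rge0 _ m0) (le_trans z_ge0).
have y_ge0 : 0 <= y by rewrite -(pmulr_rge0 _ m0) (le_trans z_ge0).
have nat_of (u : R) : u \is a Num.int -> 0 <= u -> exists k : nat, u = k%:R.
  by move=> uZ u_ge0; apply/natrP; rewrite natrEint uZ.
have [x' def_x] := nat_of x xZ x_ge0; have [y' def_y] := nat_of y yZ y_ge0.
have [z' def_z] := nat_of z zZ z_ge0.
have /choice[w' def_w] j : exists k : nat, w j = k%:R.
  by apply: nat_of => //; have /andP[] := w_itv j.
have {}w_itv j : (w' j < (a * n).+1)%N.
  by have /andP[_] := w_itv j; rewrite def_w ler_nat.
move: le_zx le_zy le_xyz; rewrite def_x def_y def_z -natrD -!natrM -natrD !ler_nat.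
move=> le_zx le_zy le_xyz.
(* Adding [le_zy] and [le_xyz] cancels [z'] and [m * y'], leaving [m * x' <= m * n]; the bound on
   [y'] is symmetric. *)
have lt_x : (x' < n.+1)%N by rewrite ltnS -(leq_pmul2l m_gt0); lia.
have lt_y : (y' < n.+1)%N by rewrite ltnS -(leq_pmul2l m_gt0); lia.
have lt_z : (z' < (m * n).+1)%N.
  by rewrite ltnS (leq_trans le_zx) // leq_mul2l -ltnS lt_x orbT.
exists (Ordinal lt_x, Ordinal lt_y, Ordinal lt_z, [ffun j => Ordinal (w_itv j)]) => /=.
  rewrite inE /= leq_subLR [(m * n + _)%N]addnC le_xyz /=.
  by rewrite minnMr leq_min le_zx.
by congr prism_point; apply/funext => j; rewrite ffunE /= def_w.
Qed.

(** The defining condition ignores the [e] cube coordinates, so each contributes a factor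
    [(a * n).+1]; the rest is [sum_reeve_points]. *)
Lemma card_dilated_prism_points : #|dilated_prism_points| =
  ((n.+1 ^ 2 + m * \sum_(x < n.+1) \sum_(y < n.+1) (minn x y - (x + y - n)))
   * (a * n).+1 ^ e)%N.
Proof.
rewrite -sum_reeve_points.
pose B (x y : 'I_n.+1) (z : 'I_(m * n).+1) : bool :=
  (m * (x + y) - m * n <= z <= m * minn x y)%N.
transitivity (\sum_(t : box) (B t.1.1.1 t.1.1.2 t.1.2 : nat))%N.
  by rewrite -sum1_card big_mkcond; apply: eq_bigr => t _; rewrite inE -/(B _ _ _); case: (B _ _ _).
rewrite -(pair_bigA _ (fun (t : 'I_n.+1 * 'I_n.+1 * 'I_(m * n).+1)
   (w : {ffun 'I_e -> 'I_(a * n).+1}) => B t.1.1 t.1.2 t.2 : nat)) /=.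
under eq_bigr do rewrite sum_nat_const card_ffun !card_ord mulnC.
rewrite -big_distrl /=; congr muln.
rewrite -(pair_bigA _ (fun (t : 'I_n.+1 * 'I_n.+1) z => B t.1 t.2 z : nat)) /=.
by rewrite -(pair_bigA _ (fun x y => \sum_z (B x y z : nat))%N).
Qed.

Lemma count_dilate_prism :
  let L := dilate n prism `&` @lattice_points R (3 + e) in
  finite_set L /\ #|` fset_set L| = #|dilated_prism_points|.
Proof.
rewrite /= dilate_prism_lattice.
have -> : [set box_point t | t in [set` dilated_prism_points]] =
    [set` [fset box_point t | t in dilated_prism_points]%fset].
  apply/seteqP; split=> [v [t /= At <-]|v /= /imfsetP[t /= At ->]].
    by apply/imfsetP; exists t.
  by exists t.
split; first exact: finite_fset.
rewrite set_fsetK card_imfset /=; last exact: box_point_inj.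
by rewrite cardE.
Qed.

End Dilate.
End Prism.

(** * The Ehrhart polynomial *)

(** The ratio of consecutive terms is (e + 1)(e - j) / (j + 1), which exceeds 1 because e - j >= 1
    and j + 1 <= e. This motivates the edge length a = e + 1. *)
Lemma binX_ltn (e j : nat) : (j < e)%N ->
  ('C(e, j) * e.+1 ^ j < 'C(e, j.+1) * e.+1 ^ j.+1)%N.
Proof.
move=> lt_je; rewrite expnS mulnA ltn_pmul2r ?expn_gt0 //.
have := mul_bin_left e j; have : (0 < 'C(e, j))%N by rewrite bin_gt0 ltnW.
have : (0 < 'C(e, j.+1))%N by rewrite bin_gt0.
nia.
Qed.

(** The left side is one term of the binomial expansion of (a + 1)^e. *)
Lemma binX_le (e a j : nat) : ('C(e, j) * a ^ j <= a.+1 ^ e)%N.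
Proof.
have [lt_ej|le_je] := ltnP e j; first by rewrite bin_small.
rewrite -addn1 addnC Pascal (bigD1 (Ordinal (le_je : (j < e.+1)%N))) //=.
by rewrite exp1n mul1n leq_addr.
Qed.

Definition prism_poly (R : realType) (e a M : nat) : {poly R} :=
  (M%:R *: 'X^3 + 'X^2 + (2 - M%:R) *: 'X + 1) * (a%:R *: 'X + 1) ^+ e.

Lemma coef_linear_exp (R : realType) (e a j : nat) :
  ((a%:R *: 'X + 1 : {poly R}) ^+ e)`_j = ('C(e, j) * a ^ j)%:R.
Proof.
rewrite addrC exprDn coef_sum.
under eq_bigr => i _ do rewrite expr1n mul1r exprZn coefMn coefZ coefXn.
have [lt_ej|le_je] := ltnP e j.
  rewrite bin_small // big1 // => i _.
  by rewrite gtn_eqF ?mulr0 ?mul0rn // (leq_ltn_trans _ lt_ej) // -ltnS.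
rewrite (bigD1 (Ordinal (le_je : (j < e.+1)%N))) //= eqxx mulr1 big1 => [|i].
  by rewrite addr0 natrM natrX mulr_natl.
by rewrite -val_eqE /= eq_sym => /negbTE ->; rewrite mulr0 mul0rn.
Qed.

Lemma prism_poly_coef0 (R : realType) (e a M : nat) :
  (prism_poly R e a M)`_0 = 1.
Proof.
rewrite /prism_poly coef0M coef_linear_exp bin0 expn0 mulr1.
by rewrite !coefD !coefZ !coefXn coefX coef1 /= !mulr0 !add0r.
Qed.

(** Since [k.-1] and [k.-2] truncate at 0, the guards supply the zero coefficients of negative
    index. *)
Lemma prism_poly_coefS (R : realType) (e a M k : nat) :
  let q j : R := ('C(e, j) * a ^ j)%:R in
  (prism_poly R e a M)`_k.+1 =
    M%:R * (if (2 <= k)%N then q k.-2 else 0)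
    + (if (1 <= k)%N then q k.-1 else 0) + (2 - M%:R) * q k + q k.+1.
Proof.
rewrite /= /prism_poly !mulrDl mul1r !coefD -!scalerAl !coefZ -!coef_linear_exp.
rewrite !coefXnM coefXM /=.
by case: k => [|[|k]]; rewrite /= ?(subSS, subn0); ring.
Qed.

(** The integers [q] increase strictly, so the terms carrying [M] total at most -M, while the others
    total at most 4 (e + 2)^e, which is less than [M]. *)
Lemma prism_poly_coef_lt0 (R : realType) (e M k : nat) :
  (5 * e.+2 ^ e <= M)%N -> (1 <= k <= e.+1)%N ->
  (prism_poly R e e.+1 M)`_k < 0.
Proof.
move=> le_M; case: k => // k /andP[_]; rewrite ltnS => le_ke.
rewrite prism_poly_coefS.
set q := fun j => ('C(e, j) * e.+1 ^ j)%N; rewrite -!/(q _).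
have qB j : (q j <= e.+2 ^ e)%N by apply: binX_le.
(* The guard matters: for [k = 0] the truncated index would give [q 0] itself, and [r < q k] would
   fail. *)
pose r := if (2 <= k)%N then q k.-2 else 0%N.
have r_lt : (r < q k)%N.
  rewrite /r; case: k le_ke @r => [|[|k]] le_ke /=.
  - by rewrite /q bin0.
  - by rewrite /q bin1 expn1 muln_gt0 le_ke.
  - by apply: ltn_trans (binX_ltn le_ke); apply: binX_ltn; apply: ltnW.
have -> : (if (2 <= k)%N then (q k.-2)%:R else 0 : R) = r%:R by rewrite /r; case: ifP.
pose s := if (1 <= k)%N then q k.-1 else 0%N.
have s_le : (s <= e.+2 ^ e)%N by rewrite /s; case: ifP.
have -> : (if (1 <= k)%N then (q k.-1)%:R else 0 : R) = s%:R by rewrite /s; case: ifP.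
have B_gt0 : (0 < e.+2 ^ e)%N by rewrite expn_gt0.
have : (M * r + s + 2 * q k + q k.+1 < M * q k)%N.
  by have := qB k; have := qB k.+1; nia.
rewrite -(ltr_nat R) !natrD !natrM; lra.
Qed.

Lemma size_prism_poly (R : realType) (e a M : nat) : (0 < a)%N -> (0 < M)%N ->
  size (prism_poly R e a M) = (3 + e).+1.
Proof.
move=> a_gt0 M_gt0.
have M0 : M%:R != 0 :> R by rewrite pnatr_eq0 -lt0n.
have a0 : a%:R != 0 :> R by rewrite pnatr_eq0 -lt0n.
have sq : size (a%:R *: 'X + 1 : {poly R}) = 2.
  by rewrite size_polyDl size_scale // ?size_polyX // size_poly1.
have st : size (M%:R *: 'X^3 + 'X^2 + (2 - M%:R) *: 'X + 1 : {poly R}) = 4.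
  rewrite -!addrA size_polyDl size_scale ?size_polyXn //.
  rewrite (leq_ltn_trans (size_polyD _ _)) // gtn_max size_polyXn /=.
  rewrite (leq_ltn_trans (size_polyD _ _)) // gtn_max size_poly1 /= andbT.
  by rewrite (leq_ltn_trans (size_scale_leq _ _)) // size_polyX.
have q0 : (a%:R *: 'X + 1 : {poly R}) ^+ e != 0.
  by rewrite expf_neq0 // -size_poly_eq0 sq.
rewrite size_mul // ?st /=; last by rewrite -size_poly_eq0 st.
have := size_exp (a%:R *: 'X + 1 : {poly R}) e; rewrite sq /= mul1n.
(* [size_exp] determines the predecessor of the size; the power is nonzero, so its size is a
   successor. *)
by move: q0; rewrite -size_poly_gt0; case: (size _) => //= k _ ->.
Qed.

(** The cubic is regrouped as (n + 1)^2 + M (n^3 - n), the shape in which the lattice point count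
    arrives. *)
Lemma horner_prism_poly (R : realType) (e a M n : nat) :
  (prism_poly R e a M).[n%:R] =
    (n.+1%:R ^+ 2 + M%:R * (n%:R ^+ 3 - n%:R)) * (a * n).+1%:R ^+ e.
Proof.
rewrite /prism_poly hornerM horner_exp !hornerE.
rewrite -[n.+1%:R]natr1 -[(a * n).+1%:R]natr1 natrM.
by congr (_ * _) => /=; ring.
Qed.

Theorem theorem0p1 (R : realType) (d : nat) (hd : (4 <= d)%N) :
  exists (N : nat) (P : set 'rV[R]_N) (p : {poly R}),
    [/\ integral_polytope P,
        has_dim P d,
        ehrhart_polynomial P d p
      & forall k : nat, (1 <= k <= d - 2)%N -> p`_k < 0].
Proof.
pose e := (d - 3)%N; have -> : d = (3 + e)%N by rewrite /e; lia.
(* The least [M] that [prism_poly_coef_lt0] admits. *)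
pose M := (5 * e.+2 ^ e)%N; have M_gt0 : (0 < M)%N by rewrite muln_gt0 expn_gt0.
have m_gt0 : (0 < 6 * M)%N by rewrite muln_gt0.
exists (3 + e)%N, (@prism R e (6 * M) e.+1), (prism_poly R e e.+1 M); split.
- exact: integral_prism.
- exact: has_dim_prism.
- split=> [||n n_gt0 /=]; [exact: size_prism_poly|exact: prism_poly_coef0|].
  have [fin ->] := @count_dilate_prism R e _ e.+1 m_gt0 isT _ n_gt0.
  split=> //; rewrite card_dilated_prism_points horner_prism_poly natrM !natrX.
  congr (_ * _); rewrite natrD natrX; congr (_ + _).
  (* The 6 in the height [6 * M] meets the 6 of [sum_reeve_height], leaving M (n^3 - n). *)
  by rewrite -natrX -(sum_reeve_height n) natrD addrK mulnAC !natrM; ring.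
- by move=> k k_itv; apply: prism_poly_coef_lt0 => //; move: k_itv; lia.
Qed.
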